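(* Let $1/3<p<1/2$ satisfy $$2^{p/(1-p)}\left(\left(\frac{1-p}{p}\right)^{1/(1-p)}-\frac{1-p}{p}\right)-\left(1+\frac{3-1/p}{2}\right)^{1/(1-p)}\ge 0 ,$$ and let $q$ be defined by $1/p+1/q=1$. Then for every sequence $(a_n)_{n\ge1}$ of positive real numbers, $$\sum_{n=1}^{\infty}\left(\sum_{k=1}^{n}\frac{a_k}{k}\right)^{q}\ \le\ \left(\frac{p}{1-p}\right)^{q}\sum_{n=1}^{\infty}a_n^{q},$$ and the constant $(p/(1-p))^q$ is best possible (it cannot be replaced by a smaller one). In particular, the displayed inequality holds for all positive sequences whenever $0<p\le 0.346$ (with $1/p+1/q=1$).
   Context: Since $0<p<1$, the conjugate exponent $q=p/(p-1)$ is negative. All series have non-negative terms and are understood as elements of $[0,\infty]$. *)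

(* Defs.v *)
From HB Require Import structures.
From mathcomp Require Import all_boot all_order all_algebra.
From mathcomp Require Import all_classical all_reals all_analysis.

Set Implicit Arguments.
Unset Strict Implicit.
Unset Printing Implicit Defensive.

Import Order.TTheory GRing.Theory Num.Theory.

Local Open Scope ring_scope.

(* Sequences are indexed from 1; the value a 0 is never constrained nor used. *)
Definition positive_seq (R : realType) (a : nat -> R) : Prop :=
  forall n : nat, (1 <= n)%N -> 0 < a n.

(* Both series are taken in \bar R, so that divergence means the value +oo. *)
Definition hardy_ineq (R : realType) (q C : R) (a : nat -> R) : Prop :=
  (\sum_(1 <= n <oo) ((\sum_(1 <= k < n.+1) a k / k%:R) `^ q)%:E
     <= C%:E * \sum_(1 <= n <oo) (a n `^ q)%:E)%E.

(* Main.v *)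
(* Put r = - q = p / (1 - p), c = 1 / r and A n = \sum_(k <= n) a k / k.  For
   weights w with w 1 = c, convexity of x ^ (- r) splits
   A (n + 1) = A n + a (n + 1) / (n + 1) in the proportions 1 - c / w (n + 1)
   and c / w (n + 1).  The resulting inequalities telescope to
   \sum A n ^ (- r) <= r ^ (- r) * \sum a n ^ (- r) as soon as
     c <= w n ^ (1 + r) / n ^ r - (w (n + 1) - c) ^ (1 + r) / (n + 1) ^ r.
   For p <= 1/3 the weights w n = n + c - 1 work.  For 1/3 < p < 1/2 one takes
   w n = n + c / 2 for n >= 2; then the case n = 1 is exactly the hypothesis of
   the theorem, and n >= 2 follows by integrating
   (1 + t / n) ^ r + (1 - t / (n + 1)) ^ r >= 2 over 0 <= t <= c / 2, which holds
   because the product of the two bases is at least 1 when t <= 1.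
   Sharpness is tested on a n = n ^ c up to a large rank N. *)
Require Import Defs.
From HB Require Import structures.
From mathcomp Require Import all_boot all_order all_algebra.
From mathcomp Require Import all_classical all_reals all_analysis.
From mathcomp Require Import ring lra.

Set Implicit Arguments.
Unset Strict Implicit.
Unset Printing Implicit Defensive.

Import Order.TTheory GRing.Theory Num.Theory.
Import numFieldNormedType.Exports.

Local Open Scope ring_scope.

(** * Real powers, Bernoulli inequalities and convexity of negative powers *)

Lemma powR_expR (R : realType) (x s : R) : 0 < x -> x `^ s = expR (s * ln x).
Proof. by move=> x0; rewrite /powR gt_eqF. Qed.

Lemma powRD_gt0 (R : realType) (x s t : R) : 0 < x ->
  x `^ (s + t) = x `^ s * x `^ t.
Proof. by move=> x0; rewrite powRD// (gt_eqF x0) implybT. Qed.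

Lemma ln_leB1 (R : realType) (x : R) : 0 < x -> ln x <= x - 1.
Proof. by move=> x0; have := expR_ge1Dx (ln x); rewrite lnK ?posrE//; lra. Qed.

Lemma bernoulli_nonpos (R : realType) (t s : R) : 0 < t -> s <= 0 ->
  1 + s * (t - 1) <= t `^ s.
Proof.
move=> t0 s0; rewrite powR_expR//; apply: le_trans (expR_ge1Dx _).
by rewrite lerD2l ler_wnM2l// ln_leB1.
Qed.

(** Apply the case of a nonpositive exponent to [t^-1] with exponent [1 - s], then multiply by
    [t]. *)
Lemma bernoulli_ge1 (R : realType) (t s : R) : 0 < t -> 1 <= s ->
  1 + s * (t - 1) <= t `^ s.
Proof.
move=> t0 s1; rewrite -[t in t `^ _]invrK -powR_inv1 ?invr_ge0 ?(ltW t0)//.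
rewrite -powRrM mulN1r -(addrK 1 (- s)).
rewrite powRD_gt0 ?invr_gt0//.
have /ler_wpM2r : 1 + (1 - s) * (t^-1 - 1) <= t^-1 `^ (- s + 1).
  by rewrite [- s + 1]addrC; apply: bernoulli_nonpos; rewrite ?invr_gt0//; lra.
rewrite powR_inv1 ?invr_ge0 ?(ltW t0)// invrK => /(_ t (ltW t0)).
apply: le_trans; rewrite le_eqVlt; apply/orP; left; apply/eqP.
by field; rewrite gt_eqF.
Qed.

Lemma bernoulli_le1 (R : realType) (t s : R) : 0 < t -> 0 < s -> s <= 1 ->
  t `^ s <= 1 + s * (t - 1).
Proof.
move=> t0 s0 s1; have u0 : 0 < t `^ s by rewrite powR_gt0.
have := @bernoulli_ge1 _ _ s^-1 u0; rewrite invf_ge1// => /(_ s1).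
rewrite -powRrM mulfV ?gt_eqF// powRr1 ?(ltW t0)// => h.
rewrite -lerBlDl -(ler_pM2l (x:=s^-1)) ?invr_gt0// mulKf ?gt_eqF//; lra.
Qed.

(** Bound each term on the right below by the tangent of [t ^ (- r)] at [t = 1], with
    [t = x / (l (x + y))] and [t = y / ((1 - l) (x + y))]. Weighted by [l] and [1 - l], the linear
    parts cancel. *)
Lemma powRN_add_le (R : realType) (r l x y : R) :
  0 < r -> 0 < l < 1 -> 0 < x -> 0 < y ->
  (x + y) `^ (- r) <= l `^ (1 + r) * x `^ (- r) + (1 - l) `^ (1 + r) * y `^ (- r).
Proof.
move=> r0 /andP[l0 l1] x0 y0; have xy : 0 < x + y by exact: addr_gt0.
have l10 : 0 < 1 - l by rewrite subr_gt0.
have aux (z m : R) : 0 < z -> 0 < m ->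
  m * (1 - r * (z / (m * (x + y)) - 1)) * (x + y) `^ (- r) <= m `^ (1 + r) * z `^ (- r).
  move=> z0 m0; set t := z / (m * (x + y)).
  have t0 : 0 < t by apply: divr_gt0 => //; apply: mulr_gt0.
  have -> : m `^ (1 + r) * z `^ (- r) = m * t `^ (- r) * (x + y) `^ (- r).
    have -> : z = t * (m * (x + y)) by rewrite /t divfK// gt_eqF// mulr_gt0.
    rewrite powRD_gt0//.
    rewrite powRr1 ?(ltW m0)// (powRM _ (ltW t0)) ?(powRM _ (ltW m0)) ?mulr_ge0 ?(ltW m0) ?(ltW xy)//.
    rewrite [m `^ (- r)]powRN; field.
    by rewrite gt_eqF// powR_gt0.
  rewrite ler_wpM2r ?powR_ge0// ler_wpM2l ?(ltW m0)//.
  by rewrite -mulNr bernoulli_nonpos// oppr_le0 ltW.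
apply: le_trans (lerD (aux _ _ x0 l0) (aux _ _ y0 l10)).
rewrite le_eqVlt; apply/orP; left; apply/eqP.
by field; rewrite !gt_eqF.
Qed.

(** * Telescoping with weights *)

Definition weighted_sum (R : realType) (a : nat -> R) (n : nat) : R :=
  \sum_(1 <= k < n.+1) a k / k%:R.

(** The boundary term on the left is what makes induction on [N] possible: it pays for the share of
    [A N.+1] in the convexity bound at the next rank. For [N = 0] the two sides agree. *)
Lemma hardy_weighted (R : realType) (r : R) (w a : nat -> R) (N : nat) :
  0 < r -> w 1%N = r^-1 -> (forall n, (1 <= n)%N -> r^-1 < w n.+1) ->
  (forall n, (1 <= n)%N ->
    r^-1 <= w n `^ (1 + r) * n%:R `^ (- r)
            - (w n.+1 - r^-1) `^ (1 + r) * n.+1%:R `^ (- r)) ->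
  positive_seq a ->
  \sum_(1 <= n < N.+2) weighted_sum a n `^ (- r)
    + (r * (w N.+1 `^ (1 + r) * N.+1%:R `^ (- r)) - 1) * weighted_sum a N.+1 `^ (- r)
  <= r `^ (- r) * \sum_(1 <= n < N.+2) a n `^ (- r).
Proof.
move=> r0 w1 wlt wle apos; set A := weighted_sum a; set c := r^-1 in w1 wlt wle *.
have c0 : 0 < c by rewrite invr_gt0.
have rc : r * c `^ (1 + r) = r `^ (- r).
  rewrite powRD_gt0//.
  by rewrite powRr1 ?ltW// mulrA mulfV ?gt_eqF// mul1r /c -powR_inv1 ?ltW// -powRrM mulN1r.
have Apos n : 0 < A n.+1.
  elim: n => [|n IHn]; first by rewrite /A /weighted_sum big_nat1 divr1 apos.
  by rewrite /A /weighted_sum big_nat_recr//= addr_gt0// divr_gt0 ?apos.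
elim: N => [|N IHN].
  rewrite !big_nat1 w1 powR1 mulr1 rc /A /weighted_sum big_nat1 divr1; lra.
rewrite big_nat_recr//= [in leRHS]big_nat_recr//= mulrDr.
set S := \sum_(1 <= n < N.+2) _ in IHN *.
set T := _ * \sum_(1 <= n < N.+2) _ in IHN *.
set W := w N.+2; have Wc : c < W by exact: wlt.
have W0 : 0 < W by exact: lt_trans Wc.
have aN : 0 < a N.+2 by exact: apos.
have lW : 0 < (W - c) / W < 1.
  by rewrite divr_gt0 ?subr_gt0//= ltr_pdivrMr// mul1r; lra.
have := @powRN_add_le _ r _ (A N.+1) (a N.+2 / N.+2%:R) r0 lW (Apos N).
rewrite divr_gt0// => /(_ isT).
have -> : A N.+1 + a N.+2 / N.+2%:R = A N.+2 by rewrite /A /weighted_sum [RHS]big_nat_recr.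
have -> : 1 - (W - c) / W = c / W by field; rewrite gt_eqF.
rewrite !powRM ?invr_ge0 ?subr_ge0 ?ler0n ?(ltW r0) ?(ltW W0) ?(ltW Wc) ?(ltW aN)//.
rewrite -!powR_inv1 ?ler0n ?(ltW W0)// -!powRrM !mulN1r opprK !powRN.
set X := W `^ (1 + r); set Y := N.+2%:R `^ r.
have X0 : 0 < X by rewrite powR_gt0.
have Y0 : 0 < Y by rewrite powR_gt0.
have {wle} := wle N.+1 isT; rewrite -/W !powRN -/Y.
set V := (W - c) `^ (1 + r).
move: IHN; rewrite !powRN -/S; set G := w N.+1 `^ (1 + r) / _; set P := (A N.+1 `^ r)^-1.
set Q := (A N.+2 `^ r)^-1; set B := (a N.+2 `^ r)^-1.
have P0 : 0 <= P by rewrite invr_ge0 powR_ge0.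
move=> IHN cG hQ.
(* Scaling the convexity bound by [r * X / Y] gives the new term of [a] exactly the coefficient
   [r ^ (- r)]. *)
have {hQ} : r * (X / Y) * Q <= r * (V / Y) * P + r `^ (- r) * B.
  rewrite -rc.
  have -> : r * (V / Y) * P + r * c `^ (1 + r) * B
     = r * (X / Y) * (V / X * P + c `^ (1 + r) / X * (B * Y)).
    by field; rewrite !gt_eqF.
  rewrite ler_pM2l// ?mulr_gt0 ?invr_gt0//.
(* This is the weight condition times [r]: the old boundary term absorbs the [P] part. *)
have : r * (V / Y) * P <= (r * G - 1) * P.
  rewrite ler_wpM2r//.
  have : r * c <= r * (G - V / Y) by rewrite ler_pM2l.
  by rewrite /c mulfV ?gt_eqF//; lra.
rewrite -powRN.
lra.
Qed.

Lemma hardy_ineq_partial (R : realType) (q C : R) (a : nat -> R) :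
  0 <= C ->
  (forall N, \sum_(1 <= n < N.+2) weighted_sum a n `^ q
             <= C * \sum_(1 <= n < N.+2) a n `^ q) ->
  hardy_ineq q C a.
Proof.
move=> C0 h; rewrite /hardy_ineq.
apply: lime_le.
  by apply: is_cvg_nneseries => n _ _; rewrite lee_fin powR_ge0.
apply: nearW => N; apply: (@le_trans _ _
    (C%:E * \sum_(1 <= n < N) (a n `^ q)%:E)%E); last first.
  apply: lee_wpmul2l; first by rewrite lee_fin.
  by apply: nneseries_lim_ge => n _ _; rewrite lee_fin powR_ge0.
rewrite !sumEFin -EFinM lee_fin.
by case: N => [|[|N]]; [rewrite !big_geq// mulr0 ..| exact: h].
Qed.

Lemma hardy_ineq_weights (R : realType) (r : R) (w a : nat -> R) :
  0 < r -> w 1%N = r^-1 -> (forall n, (1 <= n)%N -> r^-1 < w n.+1) ->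
  (forall n, (1 <= n)%N ->
    r^-1 <= w n `^ (1 + r) * n%:R `^ (- r)
            - (w n.+1 - r^-1) `^ (1 + r) * n.+1%:R `^ (- r)) ->
  positive_seq a -> hardy_ineq (- r) (r `^ (- r)) a.
Proof.
move=> r0 w1 wlt wle apos; apply: hardy_ineq_partial => [|N].
  exact: powR_ge0.
apply: le_trans (hardy_weighted N r0 w1 wlt wle apos).
rewrite lerDl mulr_ge0 ?powR_ge0// subr_ge0 -[leLHS](mulfV (lt0r_neq0 r0)).
rewrite ler_pM2l//; apply: le_trans (wle N.+1 isT) _.
by rewrite gerBl mulr_ge0 ?powR_ge0.
Qed.

(** * A monotonicity criterion and the case [r <= 1/2], that is [p <= 1/3] *)

Lemma le_of_is_derive_ge0 (R : realType) (f f' : R -> R) (a b : R) :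
  a <= b -> (forall x, a <= x <= b -> is_derive x 1 f (f' x)) ->
  (forall x, a <= x <= b -> 0 <= f' x) -> f a <= f b.
Proof.
move=> ab df f'0.
apply: (@ger0_derive1_le_cc R f a b) => //.
- move=> x; rewrite in_itv/= => /andP[ax xb].
  by have [] := df x; rewrite ?ltW.
- move=> x; rewrite in_itv/= => /andP[ax xb].
  have xab : a <= x <= b by rewrite !ltW.
  by rewrite derive1E; have [_ ->] := df x xab; exact: f'0.
- apply: derivable_within_continuous => x; rewrite in_itv/= => xab.
  by have [] := df x xab.
- by rewrite in_itv/= lexx.
- by rewrite in_itv/= lexx andbT.
Qed.

Lemma powR_sub_inv_ge (R : realType) (r s : R) : 0 < r -> 1 <= s ->
  (1 + 2 * r) * (s - 1) <= s `^ (1 + r) - s `^ (- r).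
Proof.
move=> r0 s1.
pose f x : R := x `^ (1 + r) - x `^ (- r) - (1 + 2 * r) * x.
pose f' x : R := (1 + r) * x `^ r + r * x `^ (- r - 1) - (1 + 2 * r).
suff : f 1 <= f s by rewrite /f !powR1; lra.
apply: (@le_of_is_derive_ge0 _ f f') => // x /andP[x1 _].
  have x0 : 0 < x by lra.
  have d1 u := is_derive1_powR u x0.
  rewrite /f /f'; apply: is_derive_eq.
  rewrite /GRing.scale/=. rewrite mulr1 [1 + r - 1]addrAC subrr add0r; ring.
rewrite /f' !powR_expR; [|lra..].
(* With the factors [1 + r] and [r], the logarithmic terms of these two bounds cancel and the
   constants add up to [1 + 2 r]. *)
have h1 := expR_ge1Dx (r * ln x); have h2 := expR_ge1Dx ((- r - 1) * ln x).
have : (1 + r) * (1 + r * ln x) <= (1 + r) * expR (r * ln x).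
  by rewrite ler_pM2l//; lra.
have : r * (1 + (- r - 1) * ln x) <= r * expR ((- r - 1) * ln x).
  by rewrite ler_pM2l//.
lra.
Qed.

(** This is the condition on the weights [n + c - 1], divided by [n], with [y = 1 / n]. Factor the
    base as [(1 + y) (1 + z)] and apply Bernoulli to [1 + z]; what remains is [powR_sub_inv_ge] at
    [1 + y]. The bound on [r] gives [z >= 0] and [c - 1 - 2 r >= 0]. *)
Lemma powR_weight_ge_small (R : realType) (r y : R) : 0 < r -> r <= 2^-1 -> 0 < y ->
  r^-1 * y <= (1 + (r^-1 - 1) * y) `^ (1 + r) - (1 + y) `^ (- r).
Proof.
move=> r0 r12 y0; set c := r^-1.
have c2 : 2 <= c by rewrite /c -[2]invrK lef_pV2 ?posrE.
have s0 : 0 < 1 + y by lra.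
have cr : c * r = 1 by rewrite mulVf ?gt_eqF.
set z := (c - 2) * y / (1 + y).
have z0 : 0 <= z by rewrite divr_ge0 ?mulr_ge0//; lra.
have -> : 1 + (c - 1) * y = (1 + y) * (1 + z) by rewrite /z; field; rewrite gt_eqF.
rewrite powRM; [|lra..].
have B : 1 + (1 + r) * z <= (1 + z) `^ (1 + r).
  have := @bernoulli_ge1 _ (1 + z) (1 + r); rewrite (addrC 1 z) addrK.
  by apply; lra.
have p0 : 0 < (1 + y) `^ (1 + r) by rewrite powR_gt0.
have P1 : 1 <= (1 + y) `^ r.
  by rewrite -[leLHS](powRr0 (1 + y)) ler_powR ?lerDl// ltW.
have pE : (1 + y) `^ (1 + r) * (1 + (1 + r) * z)
    = (1 + y) `^ (1 + r) + (c - 1 - 2 * r) * y * (1 + y) `^ r.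
  rewrite powRD_gt0// powRr1 ?ltW// /z.
  transitivity ((1 + y) * (1 + y) `^ r + (c - 2 + c * r - 2 * r) * y * (1 + y) `^ r).
    by field; rewrite gt_eqF.
  by rewrite cr; ring.
have : (c - 1 - 2 * r) * y <= (c - 1 - 2 * r) * y * (1 + y) `^ r.
  by rewrite ler_peMr// mulr_ge0 ?(ltW y0)//; lra.
have := @powR_sub_inv_ge _ r (1 + y) r0; rewrite lerDl (addrC 1 y) addrK => /(_ (ltW y0)).
move: B; rewrite -(ler_pM2l p0) pE (addrC y 1); lra.
Qed.

Lemma powR1D_powRN (R : realType) (x r : R) : 0 < x ->
  x `^ (1 + r) * x `^ (- r) = x.
Proof. by move=> x0; rewrite -powRD_gt0// addrK powRr1 ?ltW. Qed.

Lemma hardy_small (R : realType) (r : R) (a : nat -> R) :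
  0 < r -> r <= 2^-1 -> positive_seq a -> hardy_ineq (- r) (r `^ (- r)) a.
Proof.
move=> r0 r12; have r10 : 0 < r^-1 by rewrite invr_gt0.
apply: (@hardy_ineq_weights _ r (fun n => n%:R + (r^-1 - 1))) => // [|n n1|n n1].
- by rewrite addrC subrK.
- have : 1 <= n%:R :> R by rewrite ler1n.
  by rewrite -natr1; lra.
have n0 : 0 < n%:R :> R by rewrite ltr0n.
have -> : n.+1%:R + (r^-1 - 1) - r^-1 = n%:R :> R by rewrite -natr1; ring.
have y0 : 0 < (n%:R^-1 : R) by rewrite invr_gt0.
have := powR_weight_ge_small r0 r12 y0; rewrite -(ler_pM2l n0).
rewrite mulrC divfK ?gt_eqF//.
have -> : n%:R + (r^-1 - 1) = n%:R * (1 + (r^-1 - 1) * n%:R^-1) :> R.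
  by field; rewrite !gt_eqF.
have -> : n.+1%:R = n%:R * (1 + n%:R^-1) :> R.
  by rewrite -natr1; field; rewrite gt_eqF.
have c1 : 0 <= r^-1 - 1 by rewrite subr_ge0 invf_ge1//; lra.
have cy : 0 <= 1 + (r^-1 - 1) * n%:R^-1.
  by rewrite addr_ge0// mulr_ge0// ltW.
have y1 : 0 <= 1 + n%:R^-1 :> R by rewrite addr_ge0// ltW.
move=> h; apply: le_trans h _; rewrite !powRM ?(ltW n0)//.
rewrite -[X in X * (_ - _)](powR1D_powRN r n0) le_eqVlt; apply/orP; left.
by apply/eqP; ring.
Qed.

(** * The case [1/2 < r < 1], that is [1/3 < p < 1/2] *)

Lemma powR_gap_ge (R : realType) (r m t : R) :
  0 < r -> 1 <= m -> 0 <= t -> t <= 1 ->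
  2 * (1 + r) * t - 1 <=
    m * (1 + t / m) `^ (1 + r) - (m + 1) * (1 - t / (m + 1)) `^ (1 + r).
Proof.
move=> r0 m1 t0 t1.
have m0 : 0 < m by lra.
have m10 : 0 < m + 1 by lra.
pose f x : R := m * (1 + x * m^-1) `^ (1 + r)
  - (m + 1) * (1 - x * (m + 1)^-1) `^ (1 + r) - 2 * (1 + r) * x.
pose f' x : R := (1 + r) * ((1 + x * m^-1) `^ r + (1 - x * (m + 1)^-1) `^ r - 2).
suff : f 0 <= f t by rewrite /f !(mul0r, mulr0) !subr0 addr0 powR1; lra.
apply: (@le_of_is_derive_ge0 _ f f') => // x /andP[x0 xt].
all: have x1 : x <= 1 by lra.
all: have u0 : 0 < 1 + x * m^-1 by rewrite ltr_wpDr// mulr_ge0// invr_ge0 ltW.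
all: have v0 : 0 < 1 - x * (m + 1)^-1 by rewrite subr_gt0 ltr_pdivrMr//; lra.
  have du := is_derive1_powR (1 + r) u0.
  have dv := is_derive1_powR (1 + r) v0.
  have d1 : is_derive x 1 (fun y : R => 1 + y * m^-1) m^-1.
    apply: is_derive_eq; rewrite /GRing.scale/=; ring.
  have d2 : is_derive x 1 (fun y : R => 1 - y * (m + 1)^-1) (- (m + 1)^-1).
    apply: is_derive_eq; rewrite /GRing.scale/=; ring.
  have D1 := @is_derive1_comp _ (fun z : R => z `^ (1 + r)) _ x _ _ du d1.
  have D2 := @is_derive1_comp _ (fun z : R => z `^ (1 + r)) _ x _ _ dv d2.
  rewrite /f /f'; apply: is_derive_eq.
  rewrite /GRing.scale/= [1 + r - 1]addrAC subrr add0r.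
  by field; rewrite !gt_eqF.
(* The sum of the two powers is at least 2 plus [r] times the logarithm of the product of the bases,
   and [x <= 1] makes that product at least 1. *)
have hu := expR_ge1Dx (r * ln (1 + x * m^-1)).
have hv := expR_ge1Dx (r * ln (1 - x * (m + 1)^-1)).
have : 0 <= r * (ln (1 + x * m^-1) + ln (1 - x * (m + 1)^-1)).
  rewrite -lnM ?posrE// mulr_ge0 ?(ltW r0)// ln_ge0//.
  rewrite -subr_ge0.
  have -> : (1 + x / m) * (1 - x / (m + 1)) - 1 = x * (1 - x) / (m * (m + 1)).
    by field; rewrite !gt_eqF.
  by rewrite divr_ge0// mulr_ge0// ?subr_ge0// ltW.
move=> uv; rewrite /f' mulr_ge0//; first lra.
by rewrite !powR_expR//; lra.
Qed.

Lemma mul_powR_div (R : realType) (r m x : R) : 0 < m -> 0 <= x ->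
  m * (x / m) `^ (1 + r) = x `^ (1 + r) * m `^ (- r).
Proof.
move=> m0 x0; rewrite powRM ?invr_ge0 ?(ltW m0)//.
rewrite -[in (m^-1) `^ _]powR_inv1 ?(ltW m0)// -powRrM mulN1r !powRN.
rewrite (powRD_gt0 _ _ m0) powRr1 ?(ltW m0)//; field.
by rewrite !gt_eqF ?powR_gt0.
Qed.

Lemma hardy_large (R : realType) (r : R) (a : nat -> R) :
  2^-1 < r -> r < 1 ->
  r^-1 <= r^-1 `^ (1 + r) - (2 - r^-1 / 2) `^ (1 + r) * 2 `^ (- r) ->
  positive_seq a -> hardy_ineq (- r) (r `^ (- r)) a.
Proof.
move=> r12 r1 hr; have r0 : 0 < r by lra.
set c := r^-1 in hr *.
have c2 : c < 2 by rewrite /c -[2]invrK ltf_pV2 ?posrE.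
have c1 : 1 < c by rewrite invf_gt1.
have rc : r * c = 1 by rewrite mulfV ?gt_eqF.
apply: (@hardy_ineq_weights _ r (fun n => if n == 1%N then c else n%:R + c / 2)).
- by [].
- by [].
- move=> n n1; rewrite eqSS gtn_eqF// -natr1.
  have : 1 <= n%:R :> R by rewrite ler1n.
  by rewrite -/c; lra.
(* For [n = 1] the condition is [hr], since [w 2 - c = 2 - c / 2]. *)
move=> [//|[_|n _]] /=.
  by rewrite powR1 mulr1 -/c (_ : 2%:R + c / 2 - c = 2 - c / 2)//; field.
have m1 : 1 <= n.+2%:R :> R by rewrite ler1n.
have := @powR_gap_ge _ r n.+2%:R (c / 2) r0 m1.
rewrite natr1 -/c.
have m0 : 0 < n.+2%:R :> R by rewrite ltr0n.
have m10 : 0 < n.+3%:R :> R by rewrite ltr0n.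
have -> : 1 + c / 2 / n.+2%:R = (n.+2%:R + c / 2) / n.+2%:R.
  by field; rewrite !gt_eqF.
have -> : 1 - c / 2 / n.+3%:R = (n.+3%:R + c / 2 - c) / n.+3%:R.
  by field; rewrite !gt_eqF.
rewrite !mul_powR_div//; [|rewrite -natr1; lra|lra].
(* The shift [c / 2] gives exactly [c] here because [r c = 1]; it is at most 1 because [r > 1/2]. *)
have -> : 2 * (1 + r) * (c / 2) - 1 = c.
  by transitivity (c + r * c - 1); [field|rewrite rc; ring].
apply; lra.
Qed.

(** * Numerical verification up to [p = 0.346] *)

(** Write the power as [t ^ (16 d)] with [t = 2 ^ (- 1/16)]. Since [16 d <= 1], Bernoulli and
    [t <= 23/24] give the slope [16 / 24 = 2/3]. *)
Lemma half_powR_le (R : realType) (d : R) : 0 < d -> d <= 16^-1 ->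
  2^-1 `^ d <= 1 - 2 / 3 * d.
Proof.
move=> d0 d16; set t : R := 2^-1 `^ 16^-1.
have t0 : 0 < t by rewrite powR_gt0// invr_gt0.
have -> : 2^-1 `^ d = t `^ (16 * d).
  by rewrite /t -powRrM mulKf//; apply/eqP; lra.
have t16 : t ^+ 16 = 2^-1.
  by rewrite -powR_mulrn ?(ltW t0)// -powRrM mulVf ?powRr1//; lra.
have sqr_gt (x y z : R) : 0 <= x -> z <= x ^+ 2 -> x < y -> z < y ^+ 2.
  by move=> x0 zx xy; apply: (le_lt_trans zx); rewrite ltrXn2r.
have tle : t <= 23 / 24.
  (* Otherwise four squarings, rounded down to simple fractions, would give [t ^ 16 > 1/2]. *)
  rewrite leNgt; apply/negP => t1.
  have t2 : 45 / 49 < t ^+ 2 by apply: (sqr_gt _ _ _ _ _ t1); lra.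
  have t4 : 43 / 51 < t ^+ 2 ^+ 2 by apply: (sqr_gt _ _ _ _ _ t2); lra.
  have t8 : 27 / 38 < t ^+ 2 ^+ 2 ^+ 2 by apply: (sqr_gt _ _ _ _ _ t4); lra.
  have : 2^-1 < t ^+ 2 ^+ 2 ^+ 2 ^+ 2 by apply: (sqr_gt _ _ _ _ _ t8); lra.
  by rewrite -!exprM t16 ltxx.
apply: (le_trans (bernoulli_le1 t0 _ _)); [lra|lra|].
have : d * t <= d * (23 / 24) by rewrite ler_pM2l.
lra.
Qed.

(** The bound [173 / 327] is [p / (1 - p)] at [p = 0.346]. Expanding around [r = 1/2] with
    [d = r - 1/2] bounds every power by a polynomial in [d]. *)
Lemma hardy_condition (R : realType) (r : R) :
  2^-1 < r -> r <= 173 / 327 ->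
  r^-1 <= r^-1 `^ (1 + r) - (2 - r^-1 / 2) `^ (1 + r) * 2 `^ (- r).
Proof.
move=> r12 r53; have r0 : 0 < r by lra.
set d := r - 2^-1; have rE : r = 2^-1 + d by rewrite /d; ring.
have d0 : 0 < d by rewrite /d; lra.
have dle : d <= 19 / 654 by rewrite /d; lra.
set B : R := 2^-1 `^ d; set A : R := 2^-1 `^ 2^-1.
have B0 : 0 < B by rewrite powR_gt0// invr_gt0.
have A0 : 0 < A by rewrite powR_gt0// invr_gt0.
have Ble : B <= 1 - 2 / 3 * d by apply: half_powR_le => //; lra.
have Ale : A <= 99 / 140.
  have A2 : A ^+ 2 = 2^-1 by rewrite -powR_mulrn ?(ltW A0)// -powRrM mulVf ?powRr1.
  by rewrite -(@ler_pXn2r _ 2) ?nnegrE ?(ltW A0)// ?A2; lra.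
have hr : r `^ r = A * B * (2 * r) `^ r.
  have {1}-> : r = 2^-1 * (2 * r) by field.
  rewrite [LHS]powRM ?invr_ge0 ?mulr_ge0 ?(ltW r0)//; congr (_ * _).
  by rewrite {1}rE powRD_gt0// invr_gt0.
have hs : (2 * r - 2^-1) `^ (1 + r) * 2 `^ (- r) = B ^+ 2 / 4 * (1 + 4 * d) `^ (1 + r).
  have -> : 2 * r - 2^-1 = 2^-1 * (1 + 4 * d) by rewrite /d; field.
  rewrite powRM ?invr_ge0//; last lra.
  rewrite mulrAC; congr (_ * _).
  have -> : 2 `^ (- r) = 2^-1 `^ r :> R by rewrite -mulN1r powRrM powR_inv1.
  rewrite -powRD_gt0 ?invr_gt0//.
  have -> : 1 + r + r = d * 2%:R + 2%:R by rewrite /d; field.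
  rewrite powRD_gt0 ?invr_gt0// powRrM !powR_mulrn ?invr_ge0 ?(ltW B0)//.
  by congr (_ * _); field.
have h1 : (2 * r) `^ r <= 1 + 2 * d * r.
  have := @bernoulli_le1 _ (2 * r) r _ r0; rewrite (_ : r * _ = 2 * d * r).
    by apply; lra.
  by rewrite /d; field.
have h2 : (1 + 4 * d) `^ (1 + r) <= (1 + 4 * d) * (1 + 4 * d * r).
  rewrite powRD_gt0 ?powRr1; [|lra..].
  rewrite ler_pM2l; last lra.
  have := @bernoulli_le1 _ (1 + 4 * d) r _ r0; rewrite (_ : r * _ = 4 * d * r).
    by apply; lra.
  by ring.
(* The claim multiplied by [r `^ (1 + r)]. *)
have main : r `^ r + (2 * r - 2^-1) `^ (1 + r) * 2 `^ (- r) <= 1.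
  rewrite hr hs.
  have e1 : A * B * (2 * r) `^ r
      <= 99 / 140 * (1 - 2 / 3 * d) * (1 + 2 * d * r).
    by rewrite ler_pM ?mulr_ge0 ?powR_ge0 ?(ltW A0) ?(ltW B0)// ler_pM// ltW.
  have e2 : B ^+ 2 / 4 * (1 + 4 * d) `^ (1 + r)
      <= (1 - 2 / 3 * d) ^+ 2 / 4 * ((1 + 4 * d) * (1 + 4 * d * r)).
    rewrite ler_pM ?mulr_ge0 ?powR_ge0 ?sqr_ge0//.
    by rewrite ler_pM2r// lerXn2r// nnegrE ?(ltW B0)//; lra.
  apply: le_trans (lerD e1 e2) _; rewrite rE.
  (* The polynomial has degree 5; treating the powers of [d] as separate variables linked by these
     bounds makes the inequality linear. *)
  have pw n : 0 <= d ^+ n.+1 /\ d ^+ n.+2 <= d ^+ n.+1 * (19 / 654).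
    split; first by rewrite exprn_ge0 ?ltW.
    by rewrite [leLHS]exprSr ler_pM2l ?exprn_gt0.
  have [p1 q1] := pw 0%N; have [p2 q2] := pw 1%N.
  have [p3 q3] := pw 2%N; have [p4 q4] := pw 3%N.
  lra.
have c0 : 0 < r^-1 by rewrite invr_gt0.
have E : r^-1 `^ (1 + r) * r `^ r = r^-1.
  rewrite powRD_gt0// powRr1 ?(ltW c0)// -mulrA -powRM ?(ltW c0) ?(ltW r0)//.
  by rewrite mulVf ?gt_eqF// powR1 mulr1.
have -> : 2 - r^-1 / 2 = r^-1 * (2 * r - 2^-1) by field; rewrite gt_eqF.
rewrite powRM ?(ltW c0)//; last lra.
have p0 : 0 < r^-1 `^ (1 + r) by rewrite powR_gt0.
move: main; rewrite -(ler_pM2l p0) mulrDr E; lra.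
Qed.

(** * Sharpness of the constant *)

Lemma harmonic_unbounded (R : realType) (K : R) :
  exists N, K < series (@harmonic R) N.
Proof.
apply: contrapT => /forallNP h; apply: (@dvg_harmonic R).
apply: nondecreasing_is_cvgn.
  by apply: nondecreasing_series => n _ _; exact: harmonic_ge0.
exists K => _ [n _ <-]; rewrite leNgt; apply/negP; exact: h.
Qed.

Lemma series_harmonicS (R : realType) (n : nat) :
  series (@harmonic R) n.+1 = series harmonic n + n.+1%:R^-1.
Proof. by rewrite /series/= big_nat_recr. Qed.

(** By Bernoulli, [r (m + 1) ^ c - r m ^ c >= m ^ c / m] with [c = 1 / r >= 1], so the increments on
    the right dominate. *)
Lemma weighted_sum_powR_le (R : realType) (r : R) (n : nat) : 0 < r -> r <= 1 ->
  weighted_sum (fun k => k%:R `^ r^-1) n <= r * n.+1%:R `^ r^-1.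
Proof.
move=> r0 r1; elim: n => [|n IHn].
  by rewrite /weighted_sum big_geq// mulr_ge0 ?powR_ge0// ltW.
rewrite /weighted_sum big_nat_recr//=.
set m : R := n.+1%:R; have m0 : 0 < m by rewrite ltr0n.
have -> : n.+2%:R = m * (1 + m^-1) :> R.
  by rewrite -natr1 -/m; field; rewrite gt_eqF.
have im0 : 0 < m^-1 by rewrite invr_gt0.
have t0 : 0 < 1 + m^-1 by rewrite addr_gt0.
apply: le_trans (lerD IHn (lexx _)) _.
rewrite powRM ?(ltW m0) ?(ltW t0)// -/m.
have p0 : 0 < r * m `^ r^-1 by rewrite mulr_gt0// powR_gt0.
have := @bernoulli_ge1 _ _ r^-1 t0; rewrite invf_ge1// => /(_ r1).
rewrite -(ler_pM2l p0) mulrA; apply: le_trans; rewrite le_eqVlt.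
by apply/orP; left; apply/eqP; field; rewrite !gt_eqF.
Qed.

Lemma powRN_le (R : realType) (r x y : R) : 0 < r -> 0 < x -> x <= y ->
  y `^ (- r) <= x `^ (- r).
Proof.
move=> r0 x0 xy; have y0 := lt_le_trans x0 xy.
rewrite !powRN lef_pV2 ?posrE ?powR_gt0//.
by rewrite ge0_ler_powR ?nnegrE ?(ltW r0) ?(ltW x0) ?(ltW y0).
Qed.

(* The tail [2 ^ (n / r)] makes the series of the [a n `^ (- r)] finite without
   affecting the first [N] terms of either side. *)
Definition extremal_seq (R : realType) (r : R) (N n : nat) : R :=
  if (n <= N)%N then n%:R `^ r^-1 else (2 ^+ n) `^ r^-1.

Lemma extremal_seq_gt0 (R : realType) (r : R) (N : nat) :
  positive_seq (extremal_seq r N).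
Proof.
move=> n n1; rewrite /extremal_seq; case: ifP => _.
  by rewrite powR_gt0// ltr0n.
by rewrite powR_gt0// exprn_gt0.
Qed.

Lemma powR_inv_powRN (R : realType) (r x : R) : 0 < r -> 0 <= x ->
  (x `^ r^-1) `^ (- r) = x^-1.
Proof.
by move=> r0 x0; rewrite -powRrM mulrN mulVf ?gt_eqF// powR_inv1.
Qed.

Lemma extremal_seq_sum_le (R : realType) (r : R) (N M : nat) : 0 < r ->
  \sum_(1 <= n < M.+1) extremal_seq r N n `^ (- r)
    <= series (@harmonic R) N + 1.
Proof.
(* The terms are [1 / n] up to [N] and [2 ^ (- n)] beyond. Subtracting [2 ^ (- M)] makes the
   induction close, as its decrease pays for each tail term. *)
move=> r0; suff : \sum_(1 <= n < M.+1) extremal_seq r N n `^ (- r)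
    <= series (@harmonic R) (minn M N) + 1 - (2 ^+ M)^-1.
  move=> /le_trans; apply.
  have : 0 <= (2 ^+ M)^-1 :> R by rewrite invr_ge0 exprn_ge0.
  have : series (@harmonic R) (minn M N) <= series harmonic N.
    by apply: nondecreasing_series (geq_minr _ _) => n _ _; exact: harmonic_ge0.
  lra.
have half n : (2 ^+ n)^-1 = 2 * (2 ^+ n.+1)^-1 :> R.
  by rewrite exprS; field; rewrite expf_neq0.
elim: M => [|M IHM].
  by rewrite big_geq// min0n /series/= big_geq// expr0; lra.
rewrite big_nat_recr//=; apply: le_trans (lerD IHM (lexx _)) _.
have h0 : 0 <= (2 ^+ M.+1)^-1 :> R by rewrite invr_ge0 exprn_ge0.
rewrite /extremal_seq half; have [NM|MN] := leqP N M.
  rewrite (minn_idPr (leqW NM)) powR_inv_powRN ?exprn_ge0//.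
  lra.
rewrite (minn_idPl MN) series_harmonicS powR_inv_powRN ?ler0n//.
by move: (M.+1%:R^-1) => x; lra.
Qed.

(** Up to rank [N], each summand is at least [r ^ (- r) / (n + 1)]; this shift of index explains the
    [M.+1] and the subtracted 1. *)
Lemma extremal_weighted_sum_ge (R : realType) (r : R) (N M : nat) :
  0 < r -> r <= 1 -> (M <= N)%N ->
  r `^ (- r) * (series (@harmonic R) M.+1 - 1)
    <= \sum_(1 <= n < M.+1) weighted_sum (extremal_seq r N) n `^ (- r).
Proof.
move=> r0 r1; elim: M => [|M IHM] MN.
  by rewrite [leRHS]big_geq// /series/= big_nat1 invr1 subrr mulr0.
rewrite [leRHS]big_nat_recr//= series_harmonicS addrAC mulrDr.
apply: lerD; first by apply: IHM; exact: ltnW.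
have A0 : 0 < weighted_sum (extremal_seq r N) M.+1.
  rewrite /weighted_sum big_nat_recr//= ltr_wpDl//; last first.
    by rewrite divr_gt0// extremal_seq_gt0.
  rewrite big_nat_cond sumr_ge0// => k /andP[/andP[k1 _] _].
  by rewrite divr_ge0// ltW// extremal_seq_gt0.
have -> : r `^ (- r) * M.+2%:R^-1 = (r * M.+2%:R `^ r^-1) `^ (- r).
  by rewrite powRM ?powR_ge0 ?(ltW r0)// powR_inv_powRN.
apply: powRN_le => //; apply: le_trans (weighted_sum_powR_le _ r0 r1).
rewrite /weighted_sum le_eqVlt; apply/orP; left; apply/eqP.
apply: eq_big_nat => k /andP[_ kM].
by rewrite /extremal_seq (leq_trans _ MN).
Qed.

(** With [H] the [N]-th harmonic number, the inequality would force [K (H - 1) <= D (H + 1)], which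
    fails once [H > (K + D) / (K - D)]. *)
Lemma hardy_sharp (R : realType) (r C : R) : 0 < r -> r <= 1 ->
  C < r `^ (- r) ->
  ~ (forall a : nat -> R, positive_seq a -> hardy_ineq (- r) C a).
Proof.
move=> r0 r1 Clt hC.
set K := r `^ (- r) in Clt.
have K0 : 0 < K by rewrite powR_gt0.
(* [C] may be negative; replacing it by [D] keeps the products in the extended reals monotone. *)
set D := Num.max C 0.
have DK : D < K by rewrite /D gt_max Clt.
have D0 : 0 <= D by rewrite /D le_max lexx orbT.
have [N] := harmonic_unbounded ((K + D) / (K - D)).
rewrite ltr_pdivrMr ?subr_gt0//; apply/negP; rewrite -leNgt.
set a := extremal_seq r N.
set H := series _ N.
have hge : (K * (series (@harmonic R) N.+1 - 1) <=
    \sum_(1 <= n < N.+1) weighted_sum a n `^ (- r)) by exact: extremal_weighted_sum_ge.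
have : ((K * (series (@harmonic R) N.+1 - 1))%:E <= (D * (H + 1))%:E)%E.
  apply: (@le_trans _ _ (\sum_(1 <= n <oo) (weighted_sum a n `^ (- r))%:E)%E).
    apply: le_trans (nneseries_lim_ge N.+1 _); last first.
      by move=> n _ _; rewrite lee_fin powR_ge0.
    by rewrite sumEFin lee_fin.
  have ha := @extremal_seq_gt0 R r N.
  apply: (le_trans (hC a ha)).
  apply: (@le_trans _ _ (D%:E * \sum_(1 <= n <oo) (a n `^ (- r))%:E)%E).
    apply: lee_wpmul2r; last by rewrite lee_fin /D le_max lexx.
    by apply: nneseries_ge0 => n _ _; rewrite lee_fin powR_ge0.
  rewrite EFinM; apply: lee_wpmul2l; first by rewrite lee_fin.
  apply: lime_le.
    by apply: is_cvg_nneseries => n _ _; rewrite lee_fin powR_ge0.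
  apply: nearW => M; rewrite sumEFin lee_fin.
  case: M => [|M]; last exact: extremal_seq_sum_le.
  by rewrite big_geq// addr_ge0// /H /series/= sumr_ge0.
rewrite lee_fin series_harmonicS -/H.
have : 0 <= K * N.+1%:R^-1 by rewrite mulr_ge0// ltW.
by move: (N.+1%:R^-1) => x; lra.
Qed.

(** * Translation from [p] and [q] to [r = p / (1 - p)] *)

Lemma conjugate_expE (R : realType) (p q : R) : 0 < p -> p < 1 ->
  1 / p + 1 / q = 1 -> q = - (p / (1 - p)).
Proof.
move=> p0 p1 h; have e : q^-1 = 1 - 1 / p by lra.
rewrite -[q]invrK e.
have : p - 1 != 0 by rewrite subr_eq0 lt_eqF.
have : 1 - p != 0 by rewrite subr_eq0 gt_eqF.
by move=> p1N0 q1N0; field; rewrite p1N0 q1N0 gt_eqF.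
Qed.

Theorem corollary1p1 (R : realType) :
  (forall p q : R,
     1 / 3 < p -> p < 1 / 2 ->
     2 `^ (p / (1 - p))
         * (((1 - p) / p) `^ (1 / (1 - p)) - (1 - p) / p)
       - (1 + (3 - 1 / p) / 2) `^ (1 / (1 - p)) >= 0 ->
     1 / p + 1 / q = 1 ->
     (forall a : nat -> R, positive_seq a ->
        hardy_ineq q ((p / (1 - p)) `^ q) a)
     /\
     (forall C : R, C < (p / (1 - p)) `^ q ->
        ~ (forall a : nat -> R, positive_seq a -> hardy_ineq q C a)))
  /\
  (forall p q : R,
     0 < p -> p <= 346 / 1000 ->
     1 / p + 1 / q = 1 ->
     forall a : nat -> R, positive_seq a ->
       hardy_ineq q ((p / (1 - p)) `^ q) a).
Proof.
split=> p q; last first.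
  move=> p0 ple pq a apos.
  have p1 : 0 < 1 - p by lra.
  rewrite (conjugate_expE p0 _ pq); last lra.
  set r := p / (1 - p).
  have r0 : 0 < r by rewrite divr_gt0.
  have rle : r <= 173 / 327 by rewrite ler_pdivrMr//; lra.
  have [r12|r12] := leP r 2^-1; first exact: hardy_small.
  by apply: hardy_large => //; [lra|exact: hardy_condition].
move=> p13 p12 + pq.
have p0 : 0 < p by lra.
have p1 : 0 < 1 - p by lra.
rewrite (conjugate_expE p0 _ pq); last lra.
have -> : (1 - p) / p = (p / (1 - p))^-1 by rewrite invf_div.
have -> : 1 / (1 - p) = 1 + p / (1 - p) by field; rewrite gt_eqF.
have -> : 1 / p = 1 + (p / (1 - p))^-1 by rewrite invf_div; field; rewrite gt_eqF.
set r := p / (1 - p) => hr.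
have r0 : 0 < r by rewrite divr_gt0.
have r12 : 2^-1 < r by rewrite ltr_pdivlMr//; lra.
have r1 : r < 1 by rewrite ltr_pdivrMr//; lra.
split=> [a apos|C Clt]; last by apply: hardy_sharp => //; exact: ltW.
apply: hardy_large => //.
have P0 : 0 < 2 `^ r :> R by rewrite powR_gt0.
(* Multiplied by [2 ^ r], the condition of [hardy_large] becomes the hypothesis [hr] rearranged. *)
rewrite -(ler_pM2l P0) powRN.
have E : 1 + (3 - (1 + r^-1)) / 2 = 2 - r^-1 / 2 by field; rewrite gt_eqF.
rewrite E in hr.
have -> : 2 `^ r * (r^-1 `^ (1 + r) - (2 - r^-1 / 2) `^ (1 + r) / 2 `^ r)
  = 2 `^ r * r^-1 `^ (1 + r) - (2 - r^-1 / 2) `^ (1 + r).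
  by field; rewrite !gt_eqF.
lra.
Qed.
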